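(* Assume that the super Poincaré inequality $$\mu(f^2)\le r\,\mathcal E(f)+\beta(r)\,\mu(|f|)^2,\qquad r>0,\ f\in\mathcal D(\mathcal E),$$ holds for some decreasing function $\beta:(0,\infty)\to(0,\infty)$. Suppose there exists a constant $\kappa_1>0$ such that $\kappa_2:=\mu(e^{-2V})<\infty$ and $$|V(x)-V(y)|\le\kappa_1\big(1\wedge d(x,y)\big)\quad\text{for all }(x,y)\text{ with }q(x,y)>0.$$ Then $$\mu_V(f^2)\le s\,\mathcal E_V(f)+\beta_V(s)\,\mu_V(|f|)^2,\qquad s>0,\ f\in\mathcal D(\mathcal E_V),$$ holds with $$\beta_V(s):=\inf\Big\{16\kappa_2\beta(r)^3(4+\lambda\kappa_1^2s'):\ s'\in(0,s],\ 0<r\le\frac{s'e^{-\kappa_1}}{4+\lambda\kappa_1^2s'}\Big\},\qquad s>0.$$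
   Context: Setting: $(E,d)$ is a Polish space with Borel $\sigma$-field and a probability measure $\mu$. Let $q:E\times E\to[0,\infty)$ be measurable with $q(x,x)=0$ for all $x$, and $\lambda:=\sup_{x\in E}\int_E(1\wedge d(x,y)^2)q(x,y)\,\mu(\mathrm dy)<\infty.$ For bounded measurable $f,g$ set $\Gamma(f,g)(x)=\int_E(f(x)-f(y))(g(x)-g(y))q(x,y)\mu(\mathrm dy)$; $\mathcal A$ is the set of bounded measurable $f$ with $\Gamma(f,f)$ bounded, assumed dense in $L^2(\mu)$. $(\mathcal E,\mathcal D(\mathcal E))$ is the closure in $L^2(\mu)$ of $\mathcal E(f,g)=\mu(\Gamma(f,g))$ on $\mathcal A$, $\mathcal E(f)=\mathcal E(f,f)$. Fix $o\in E$, $\rho(x)=d(o,x)$. $V$ is a measurable function bounded on each set $\{\rho\le r\}$, $r>0$, with $\mu(e^V)=1$; $\mu_V(\mathrm dx)=e^{V(x)}\mu(\mathrm dx)$, and $(\mathcal E_V,\mathcal D(\mathcal E_V))$ is the closure in $L^2(\mu_V)$ of $\mathcal E_V(f,g)=\mu_V(\Gamma(f,g))$ on $\mathcal A$, $\mathcal E_V(f)=\mathcal E_V(f,f)$. *)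

(* Defs.v *)
From HB Require Import structures.
From mathcomp Require Import all_boot all_order all_algebra.
From mathcomp Require Import all_classical all_reals all_analysis.
Set Implicit Arguments. Unset Strict Implicit. Unset Printing Implicit Defensive.
Import Order.TTheory GRing.Theory Num.Theory.
Local Open Scope classical_set_scope.
Local Open Scope ring_scope.

Definition is_metric (R : realType) (T : Type) (d : T -> T -> R) : Prop :=
  (forall x y, 0 <= d x y) /\ (forall x y, d x y = 0 <-> x = y) /\
  (forall x y, d x y = d y x) /\ (forall x y z, d x z <= d x y + d y z).

Definition metric_complete (R : realType) (T : Type) (d : T -> T -> R) : Prop :=
  forall u : nat -> T,
    (forall e : R, 0 < e -> exists N : nat, forall n m : nat,
        (N <= n)%N -> (N <= m)%N -> d (u n) (u m) < e) ->
    exists x : T, forall e : R, 0 < e -> exists N : nat, forall n : nat,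
        (N <= n)%N -> d (u n) x < e.

Definition metric_separable (R : realType) (T : Type) (d : T -> T -> R) : Prop :=
  exists D : set T, countable D /\
    forall x (e : R), 0 < e -> exists2 y, D y & d x y < e.

Definition metric_open (R : realType) (T : Type) (d : T -> T -> R) : set (set T) :=
  [set A | forall x, A x -> exists2 e : R, 0 < e & [set y | d x y < e] `<=` A].

Definition polish_borel (R : realType) (dm : measure_display) (E : measurableType dm)
    (d : E -> E -> R) : Prop :=
  [/\ is_metric d, metric_complete d, metric_separable d &
      (@measurable dm E) = <<s metric_open d >>].

Local Open Scope ereal_scope.

Definition Gamma (R : realType) (dm : measure_display) (E : measurableType dm)
    (mu : {measure set E -> \bar R}) (q : E -> E -> R) (f : E -> R) (x : E) : \bar R :=
  \int[mu]_y (((f x - f y) ^+ 2 * q x y)%R%:E).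

Definition inA (R : realType) (dm : measure_display) (E : measurableType dm)
    (mu : {measure set E -> \bar R}) (q : E -> E -> R) (f : E -> R) : Prop :=
  [/\ measurable_fun setT f,
      (exists M : R, forall x, (`|f x| <= M)%R) &
      (exists M : R, forall x, Gamma mu q f x <= M%:E)].

(* integrals w.r.t. the measure w(x) mu(dx) (w = 1 gives mu, w = e^V gives mu_V) *)
Definition wint2 (R : realType) (dm : measure_display) (E : measurableType dm)
    (mu : {measure set E -> \bar R}) (w : E -> R) (g : E -> R) : \bar R :=
  \int[mu]_x (((g x) ^+ 2 * w x)%R%:E).

Definition wint1 (R : realType) (dm : measure_display) (E : measurableType dm)
    (mu : {measure set E -> \bar R}) (w : E -> R) (g : E -> R) : \bar R :=
  \int[mu]_x ((`|g x| * w x)%R%:E).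

Definition energy (R : realType) (dm : measure_display) (E : measurableType dm)
    (mu : {measure set E -> \bar R}) (q : E -> E -> R) (w : E -> R) (f : E -> R) : \bar R :=
  \int[mu]_x (Gamma mu q f x * (w x)%:E).

(* form_closure mu q w f e : f belongs to the domain of the closure in
   L^2(w mu) of the form (energy mu q w) on A, and the closed form takes
   the value e at f. *)
Definition form_closure (R : realType) (dm : measure_display) (E : measurableType dm)
    (mu : {measure set E -> \bar R}) (q : E -> E -> R) (w : E -> R) (f : E -> R) (e : R)
    : Prop :=
  [/\ measurable_fun setT f, wint2 mu w f < +oo &
    exists u : nat -> E -> R,
      [/\ forall n, inA mu q (u n),
          (forall eps : R, (0 < eps)%R -> exists N : nat, forall n : nat,
              (N <= n)%N -> wint2 mu w (u n \- f)%R <= eps%:E),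
          (forall eps : R, (0 < eps)%R -> exists N : nat, forall n m : nat,
              (N <= n)%N -> (N <= m)%N -> energy mu q w (u n \- u m)%R <= eps%:E) &
          (forall eps : R, (0 < eps)%R -> exists N : nat, forall n : nat,
              (N <= n)%N -> (e - eps)%R%:E <= energy mu q w (u n) /\
                            energy mu q w (u n) <= (e + eps)%R%:E)]].

Definition jump_lambda (R : realType) (dm : measure_display) (E : measurableType dm)
    (mu : {measure set E -> \bar R}) (d : E -> E -> R) (q : E -> E -> R) : \bar R :=
  ereal_sup (range (fun x => \int[mu]_y ((Num.min 1 (d x y ^+ 2) * q x y)%R%:E))).

Local Close Scope ereal_scope.

Definition betaV (R : realType) (beta : R -> R) (kappa1 kappa2 lambda s : R) : R :=
  inf [set y : R | exists s' r : R,
        [/\ 0 < s' <= s,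
            0 < r <= s' * expR (- kappa1) / (4 + lambda * kappa1 ^+ 2 * s') &
            y = 16 * kappa2 * beta r ^+ 3 * (4 + lambda * kappa1 ^+ 2 * s')]].

(* Main.v *)
Require Import Defs.
From HB Require Import structures.
From mathcomp Require Import all_boot all_order all_algebra.
From mathcomp Require Import all_classical all_reals all_analysis.
From mathcomp Require Import measurable_realfun ring lra.
Import Order.TTheory GRing.Theory Num.Theory.
Local Open Scope classical_set_scope.
Local Open Scope ring_scope.

(** Apply the super Poincaré inequality for [mu] to [g = f e^{W/2}] with
    [W = min (V, n)], which lies in [A] because [W] inherits the increment bound
    of [V]. That bound, [kappa1] on [{q > 0}], gives
    [E(g) <= 2 e^kappa1 E_V(f) + e^kappa1 kappa1^2 lambda / 2 mu_V(f^2)]; let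
    [n] go to infinity. Splitting according to [K e^{V/2} >= 1] or not,
    [mu(|f| e^{V/2})^2 <= 2 K^2 mu_V(|f|)^2 + 2 mu_V(f^2) kappa2 / K^4]. With
    [K^2 = 2 beta(r) kappa2] and the stated range of [r], the terms in
    [mu_V(f^2)] are absorbed; [beta >= 1] (test [f = 1]) and [kappa2 >= 1]
    (convexity) turn the constant into the one of the statement. *)

(** * Integration of pointwise bounds; measurability of the distance *)

Lemma le_integral_lincomb (R : realType) (dm : measure_display)
    (T : measurableType dm) (mu : {measure set T -> \bar R})
    (g h1 h2 : T -> \bar R) (a b : R) :
  measurable_fun setT g -> measurable_fun setT h1 -> measurable_fun setT h2 ->
  (forall x, 0 <= g x)%E -> (forall x, 0 <= h1 x)%E -> (forall x, 0 <= h2 x)%E ->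
  0 <= a -> 0 <= b ->
  (forall x, g x <= a%:E * h1 x + b%:E * h2 x)%E ->
  (\int[mu]_x g x <= a%:E * \int[mu]_x h1 x + b%:E * \int[mu]_x h2 x)%E.
Proof.
move=> mg mh1 mh2 g0 h10 h20 a0 b0 gle.
have m1 : measurable_fun setT (fun x => a%:E * h1 x)%E by exact: measurable_funeM.
have m2 : measurable_fun setT (fun x => b%:E * h2 x)%E by exact: measurable_funeM.
rewrite -!ge0_integralZl_EFin// -ge0_integralD//; last 2 first.
- by move=> x _; rewrite mule_ge0.
- by move=> x _; rewrite mule_ge0.
by apply: ge0_le_integral => //; exact: emeasurable_funD.
Qed.

(** Preimages of the rays []-oo, r[] are open balls, hence metrically open, and these rays generate
    the Borel sets of the line. *)
Lemma polish_borel_measurable_dist (R : realType) (dm : measure_display)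
    (E : measurableType dm) (d : E -> E -> R) (x : E) :
  polish_borel d -> measurable_fun setT (d x).
Proof.
move=> [[d0 [_ [dC dtri]]] _ _ bE].
apply: (measurability (@RGenInftyO.G R)); first exact: RGenInftyO.measurableE.
move=> _ [_ [r ->] <-]; rewrite setTI bE; apply: sub_sigma_algebra => y /=.
rewrite in_itv/= => xyr; exists (r - d x y); first by rewrite subr_gt0.
move=> z /= yz; rewrite in_itv/=; apply: le_lt_trans (dtri _ y _) _; lra.
Qed.

(** * Pointwise exponential inequalities *)

(** Convexity gives [e^t - e^s <= e^t (t - s)] for [s <= t]. The larger exponent exceeds [v] by at
    most [k m <= k], which costs the factor [e^k]; halving the exponents gives the [1/4]. *)
Lemma expR_half_diff_sqr_le (R : realType) (k m v w : R) :
  0 <= k -> 0 <= m -> m <= 1 -> `|v - w| <= k * m ->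
  (expR (v / 2) - expR (w / 2)) ^+ 2 <= expR k * expR v * (k ^+ 2 * m ^+ 2) / 4.
Proof.
move=> k0 m0 m1 vw.
have lip (s t : R) : s <= t -> expR t - expR s <= expR t * (t - s).
  move=> st; have := expR_ge1Dx (s - t); rewrite expRD expRN => h.
  have et : 0 < expR t by exact: expR_gt0.
  have : expR t * (1 + (s - t)) <= expR t * (expR s / expR t) by rewrite ler_pM2l.
  by rewrite mulrCA divff ?gt_eqF// mulr1; lra.
have km : k * m <= k by rewrite ler_piMr.
have sq (t : R) : expR (t / 2) ^+ 2 = expR t.
  by rewrite expr2 -expRD; congr expR; lra.
(* [t] and [s] stand for the larger and the smaller of [v] and [w]; [t <= v + k] holds in either
   order. *)
have bound (s t : R) : s <= t -> t <= v + k -> t - s <= k * m ->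
    (expR (t / 2) - expR (s / 2)) ^+ 2 <= expR k * expR v * (k ^+ 2 * m ^+ 2) / 4.
  move=> st tv tskm.
  have h0 : 0 <= expR (t / 2) - expR (s / 2) by rewrite subr_ge0 ler_expR; lra.
  apply: (@le_trans _ _ ((expR (t / 2) * (t / 2 - s / 2)) ^+ 2)).
    by rewrite ler_sqr ?nnegrE ?(le_trans h0)//; apply: lip; lra.
  rewrite exprMn sq -expRD.
  have -> : expR (k + v) * (k ^+ 2 * m ^+ 2) / 4 = expR (k + v) * (k * m / 2) ^+ 2.
    by field.
  apply: ler_pM; rewrite ?expR_ge0 ?sqr_ge0 ?ler_expR//; first lra.
  by rewrite ler_sqr ?nnegrE; lra.
have [vlew|wltv] := leP v w.
  rewrite -sqrrN opprB; apply: bound => //.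
  - by move: vw; rewrite ler_norml; lra.
  - by move: vw; rewrite ler_norml; lra.
by move: vw; rewrite ler_norml => vw; apply: bound; lra.
Qed.

(** Split the difference as [e^{w/2} (a - b) + a (e^{v/2} - e^{w/2})] and use
    [(x + y)^2 <= 2 x^2 + 2 y^2]. The weights keep only [v], so that with [v = W x] they come out of
    an integral in [y]. *)
Lemma expR_half_weighted_diff_sqr_le (R : realType) (k m v w a b : R) :
  0 <= k -> 0 <= m -> m <= 1 -> `|v - w| <= k * m ->
  (a * expR (v / 2) - b * expR (w / 2)) ^+ 2 <=
  2 * expR k * expR v * (a - b) ^+ 2 +
  expR k * expR v * k ^+ 2 * a ^+ 2 / 2 * m ^+ 2.
Proof.
move=> k0 m0 m1 vw; have := expR_half_diff_sqr_le _ _ _ _ _ k0 m0 m1 vw.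
set ev := expR (v / 2); set ew := expR (w / 2) => de.
have ewk : ew ^+ 2 <= expR k * expR v.
  rewrite /ew expr2 -!expRD ler_expR; move: vw; rewrite ler_norml.
  have : k * m <= k by rewrite ler_piMr.
  lra.
have h1 : ew ^+ 2 * (a - b) ^+ 2 <= expR k * expR v * (a - b) ^+ 2.
  by rewrite ler_wpM2r ?sqr_ge0.
have h2 : a ^+ 2 * (ev - ew) ^+ 2 <=
    a ^+ 2 * (expR k * expR v * (k ^+ 2 * m ^+ 2) / 4).
  by rewrite ler_wpM2l ?sqr_ge0.
have h3 : 0 <= (ew * (a - b) - a * (ev - ew)) ^+ 2 by exact: sqr_ge0.
have -> : a * ev - b * ew = ew * (a - b) + a * (ev - ew) by ring.
by move: (expR k) (expR v) h1 h2 h3 => K V h1 h2 h3; nra.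
Qed.

(** * Basic facts on [Gamma], and its bound at [f e^{W/2}] *)

Lemma probability_integral_cst (R : realType) (dm : measure_display)
    (E : measurableType dm) (mu : probability E R) (r : \bar R) :
  (\int[mu]_x r = r)%E.
Proof. by rewrite integral_cst// [X in (_ * X)%E]probability_setT mule1. Qed.

Lemma Gamma_ge0 (R : realType) (dm : measure_display) (E : measurableType dm)
    (mu : {measure set E -> \bar R}) (q : E -> E -> R) (f : E -> R) (x : E) :
  (forall x y, 0 <= q x y) -> (0 <= Gamma mu q f x)%E.
Proof.
by move=> q0; apply: integral_ge0 => y _; rewrite lee_fin mulr_ge0 ?sqr_ge0.
Qed.

Lemma measurable_Gamma (R : realType) (dm : measure_display) (E : measurableType dm)
    (mu : probability E R) (q : E -> E -> R) (f : E -> R) :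
  measurable_fun setT (fun p : E * E => q p.1 p.2) -> (forall x y, 0 <= q x y) ->
  measurable_fun setT f -> measurable_fun setT (Gamma mu q f).
Proof.
move=> mq q0 mf.
apply: (@measurable_fun_fubini_tonelli_F _ _ _ _ _ mu
  (fun p => ((f p.1 - f p.2) ^+ 2 * q p.1 p.2)%:E)).
- apply/measurable_EFinP; apply: measurable_funM => //.
  by apply: measurable_funX; apply: measurable_funB; exact: measurableT_comp.
- by move=> p; rewrite lee_fin mulr_ge0 ?sqr_ge0.
Qed.

Lemma measurable_Gamma_integrand (R : realType) (dm : measure_display)
    (E : measurableType dm) (q : E -> E -> R) (f : E -> R) (x : E) :
  measurable_fun setT (fun p : E * E => q p.1 p.2) -> measurable_fun setT f ->
  measurable_fun setT (fun y => (((f x - f y) ^+ 2 * q x y)%:E)).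
Proof.
move=> mq mf; apply/measurable_EFinP; apply: measurable_funM.
  by apply: measurable_funX; exact: measurable_funB.
exact: (measurable_fun_pair2 _ mq).
Qed.

(** The pointwise bound with [m = min (1, d x y)] is integrated in [y]: its first term gives [Gamma]
    of [f], its second the jump integral at [x]. *)
Lemma Gamma_expR_half_le (R : realType) (dm : measure_display)
    (E : measurableType dm) (d : E -> E -> R) (mu : {measure set E -> \bar R})
    (q : E -> E -> R) (f W : E -> R) (k L : R) (x : E) :
  polish_borel d -> measurable_fun setT (fun p : E * E => q p.1 p.2) ->
  (forall x y, 0 <= q x y) -> 0 <= k ->
  (\int[mu]_y (Num.min 1 (d x y ^+ 2) * q x y)%:E <= L%:E)%E ->
  measurable_fun setT f -> measurable_fun setT W ->
  (forall y, 0 < q x y -> `|W x - W y| <= k * Num.min 1 (d x y)) ->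
  (Gamma mu q (fun x => f x * expR (W x / 2))%R x <=
   (2 * expR k * expR (W x))%:E * Gamma mu q f x +
   (expR k * expR (W x) * k ^+ 2 * f x ^+ 2 / 2 * L)%:E)%E.
Proof.
move=> bd mq q0 k0 jump mf mW Wd.
set c1 := 2 * _ * _; set c2 := (X in (X * L)%:E).
have c10 : 0 <= c1 by rewrite !mulr_ge0 ?expR_ge0.
have c20 : 0 <= c2 by rewrite divr_ge0// mulr_ge0 ?sqr_ge0// mulr_ge0 ?sqr_ge0.
have mqx : measurable_fun setT (q x) by exact: (measurable_fun_pair2 _ mq).
have dge0 y : 0 <= d x y by case: bd => [[+ _] _ _ _]; exact.
apply: (@le_trans _ _ (c1%:E * Gamma mu q f x +
    c2%:E * \int[mu]_y (Num.min 1 (d x y ^+ 2) * q x y)%:E)%E); last first.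
  by rewrite leeD2l// (EFinM c2) lee_wpmul2l.
apply: le_integral_lincomb => //.
- apply: measurable_Gamma_integrand => //; apply: measurable_funM => //.
  by apply: measurableT_comp => //; exact: measurable_funM.
- exact: measurable_Gamma_integrand.
- apply/measurable_EFinP; apply: measurable_funM => //.
  apply: measurable_minr => //; apply: measurable_funX.
  exact: polish_borel_measurable_dist.
- by move=> y; rewrite lee_fin mulr_ge0 ?sqr_ge0.
- by move=> y; rewrite lee_fin mulr_ge0 ?sqr_ge0.
- by move=> y; rewrite lee_fin mulr_ge0// le_min ler01 sqr_ge0.
move=> y; rewrite -!EFinM -EFinD lee_fin.
(* The increment bound is given only where [q x y > 0]; elsewhere both sides vanish. *)
have [qxy|qxy] := ltP 0 (q x y); last first.
  have -> : q x y = 0 by apply/eqP; rewrite eq_le qxy q0.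
  by rewrite !mulr0 addr0.
rewrite (mulrA c1) (mulrA c2) -mulrDl ler_pM2r//.
have -> : Num.min 1 (d x y ^+ 2) = Num.min 1 (d x y) ^+ 2.
  have [d1|d1] := leP 1 (d x y).
    by rewrite expr1n min_l// exprn_ege1.
  by rewrite min_r// exprn_ile1// ltW.
apply: expR_half_weighted_diff_sqr_le; rewrite ?Wd//.
- by rewrite le_min ler01 dge0.
- by rewrite ge_min lexx.
Qed.

(** Here the truncation of [V] pays off: the upper bound [b] on [W] bounds [f e^{W/2}] and, through
    the preceding estimate, its [Gamma]. *)
Lemma inA_mul_expR_half (R : realType) (dm : measure_display)
    (E : measurableType dm) (d : E -> E -> R) (mu : {measure set E -> \bar R})
    (q : E -> E -> R) (f W : E -> R) (k L b : R) :
  polish_borel d -> measurable_fun setT (fun p : E * E => q p.1 p.2) ->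
  (forall x y, 0 <= q x y) -> 0 <= k -> 0 <= L ->
  (forall x, \int[mu]_y (Num.min 1 (d x y ^+ 2) * q x y)%:E <= L%:E)%E ->
  inA mu q f -> measurable_fun setT W -> (forall x, W x <= b) ->
  (forall x y, 0 < q x y -> `|W x - W y| <= k * Num.min 1 (d x y)) ->
  inA mu q (fun x => f x * expR (W x / 2))%R.
Proof.
move=> bd mq q0 k0 L0 jump [mf [M fM] [G fG]] mW Wb Wd.
split.
- apply: measurable_funM => //.
  by apply: measurableT_comp => //; exact: measurable_funM.
- exists (M * expR (b / 2)) => x; rewrite normrM (ger0_norm (expR_ge0 _)).
  by apply: ler_pM; rewrite ?expR_ge0// ler_expR ler_pM2r.
exists (2 * expR k * expR b * `|G| + expR k * expR b * k ^+ 2 * M ^+ 2 / 2 * L).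
move=> x; have := Gamma_expR_half_le _ _ _ _ _ _ _ _ _ _ x bd mq q0 k0 (jump x) mf mW (Wd x).
move=> /le_trans; apply.
have eWb : expR (W x) <= expR b by rewrite ler_expR.
have fM2 : f x ^+ 2 <= M ^+ 2.
  by rewrite -real_normK ?num_real// ler_sqr ?nnegrE// (le_trans _ (fM x)).
have ek := expR_ge0 k; have ew := expR_ge0 (W x).
rewrite EFinD; apply: leeD.
  rewrite [leRHS]EFinM; apply: lee_pmul.
  - by rewrite lee_fin !mulr_ge0.
  - exact: Gamma_ge0.
  - by rewrite lee_fin ler_wpM2l// mulr_ge0.
  - by apply: le_trans (fG x) _; rewrite lee_fin ler_norm.
rewrite lee_fin ler_wpM2r// ler_wpM2r//.
apply: ler_pM; rewrite ?sqr_ge0// ?mulr_ge0 ?sqr_ge0//.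
by rewrite ler_wpM2r ?sqr_ge0// ler_wpM2l.
Qed.

(** * The super Poincaré inequality for [mu] applied to [f e^{W/2}] *)

(** The constant sequence [f] approximates [f]. This makes the hypothesis on the closed form
    available for members of [A]. *)
Lemma form_closure_cst (R : realType) (dm : measure_display)
    (E : measurableType dm) (mu : probability E R) (q : E -> E -> R)
    (f : E -> R) (e : R) :
  measurable_fun setT (fun p : E * E => q p.1 p.2) -> (forall x y, 0 <= q x y) ->
  inA mu q f -> energy mu q (fun=> 1%R) f = e%:E ->
  form_closure mu q (fun=> 1%R) f e.
Proof.
move=> mq q0 fA ef; have [mf [M fM] _] := fA.
have z2 : wint2 mu (fun=> 1%R) (f \- f)%R = 0%E.
  by apply: integral0_eq => x _ /=; rewrite subrr expr0n mul0r.
have ze : energy mu q (fun=> 1%R) (f \- f)%R = 0%E.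
  apply: integral0_eq => x _; rewrite /Gamma integral0_eq ?mul0e// => y _ /=.
  by rewrite !subrr expr0n mul0r.
split => //.
  apply: (@le_lt_trans _ _ (\int[mu]_x (M ^+ 2)%:E)%E).
    apply: ge0_le_integral => //.
    - by move=> x _; rewrite lee_fin mulr1 sqr_ge0.
    - by apply/measurable_EFinP; under eq_fun do rewrite mulr1; exact: measurable_funX.
    - move=> x _; rewrite lee_fin mulr1 -real_normK ?num_real//.
      by rewrite ler_sqr ?nnegrE// (le_trans _ (fM x)).
  by rewrite probability_integral_cst ltry.
exists (fun=> f); split => //.
- by move=> eps eps0; exists 0%N => n _; rewrite z2 lee_fin ltW.
- by move=> eps eps0; exists 0%N => n m _ _; rewrite ze lee_fin ltW.
- move=> eps eps0; exists 0%N => n _; rewrite ef !lee_fin; split; lra.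
Qed.

Lemma measurable_weighted_integrands (R : realType) (dm : measure_display)
    (E : measurableType dm) (f w : E -> R) :
  measurable_fun setT f -> measurable_fun setT w ->
  measurable_fun setT (fun x => (f x ^+ 2 * w x)%:E) /\
  measurable_fun setT (fun x => (`|f x| * w x)%:E).
Proof.
move=> mf mw; split; apply/measurable_EFinP; apply: measurable_funM => //.
  exact: measurable_funX.
exact: measurableT_comp.
Qed.

(** The bound on [Gamma] is integrated in [x]; replacing [e^W] by [e^V] makes the right side
    independent of the truncation. *)
Lemma energy_expR_half_le (R : realType) (dm : measure_display)
    (E : measurableType dm) (d : E -> E -> R) (mu : probability E R)
    (q : E -> E -> R) (f V W : E -> R) (k L : R) :
  polish_borel d -> measurable_fun setT (fun p : E * E => q p.1 p.2) ->
  (forall x y, 0 <= q x y) -> 0 <= k -> 0 <= L ->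
  (forall x, \int[mu]_y (Num.min 1 (d x y ^+ 2) * q x y)%:E <= L%:E)%E ->
  measurable_fun setT f -> measurable_fun setT V -> measurable_fun setT W ->
  (forall x, W x <= V x) ->
  (forall x y, 0 < q x y -> `|W x - W y| <= k * Num.min 1 (d x y)) ->
  (energy mu q (fun=> 1%R) (fun x => f x * expR (W x / 2))%R <=
   (2 * expR k)%:E * energy mu q (fun x => expR (V x)) f +
   (expR k * k ^+ 2 / 2 * L)%:E * wint2 mu (fun x => expR (V x)) f)%E.
Proof.
move=> bd mq q0 k0 L0 jump mf mV mW WV Wd.
have meV : measurable_fun setT (fun x => expR (V x)) by exact: measurableT_comp.
have c0 : 0 <= expR k * k ^+ 2 / 2 * L by rewrite !mulr_ge0 ?sqr_ge0.
apply: le_integral_lincomb => //.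
- apply: emeasurable_funM => //; apply: measurable_Gamma => //.
  apply: measurable_funM => //; apply: measurableT_comp => //.
  exact: measurable_funM.
- apply: emeasurable_funM; first exact: measurable_Gamma.
  exact/measurable_EFinP.
- exact: (measurable_weighted_integrands _ _ _ _ _ mf meV).1.
- by move=> x; rewrite mule1 Gamma_ge0.
- by move=> x; rewrite mule_ge0 ?Gamma_ge0// lee_fin.
- by move=> x; rewrite lee_fin mulr_ge0 ?sqr_ge0.
move=> x; rewrite mule1.
have := Gamma_expR_half_le _ _ _ _ _ _ _ _ _ _ x bd mq q0 k0 (jump x) mf mW (Wd x).
move=> /le_trans; apply; have eWV : expR (W x) <= expR (V x) by rewrite ler_expR.
apply: leeD.
  rewrite (muleC (Gamma _ _ _ _)) muleA -EFinM lee_wpmul2r ?Gamma_ge0// lee_fin.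
  by rewrite ler_wpM2l// mulr_ge0.
rewrite -EFinM lee_fin.
have -> : expR k * expR (W x) * k ^+ 2 * f x ^+ 2 / 2 * L =
  expR k * k ^+ 2 / 2 * L * (f x ^+ 2 * expR (W x)) by ring.
by rewrite ler_wpM2l// ler_wpM2l ?sqr_ge0.
Qed.

(** The left side is [mu(g^2)] for [g = f e^{W/2}]. The right side involves [V] alone, so it is
    uniform over truncations. *)
Lemma wint2_expR_trunc_le (R : realType) (dm : measure_display)
    (E : measurableType dm) (d : E -> E -> R) (mu : probability E R)
    (q : E -> E -> R) (f V W : E -> R) (k L b r br Ev A D : R) :
  polish_borel d -> measurable_fun setT (fun p : E * E => q p.1 p.2) ->
  (forall x y, 0 <= q x y) -> 0 <= k -> 0 <= L -> 0 <= r -> 0 <= br ->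
  (forall x, \int[mu]_y (Num.min 1 (d x y ^+ 2) * q x y)%:E <= L%:E)%E ->
  (forall (f : E -> R) (e : R), form_closure mu q (fun=> 1%R) f e ->
     (wint2 mu (fun=> 1%R) f <= (r * e)%:E
        + br%:E * (wint1 mu (fun=> 1%R) f * wint1 mu (fun=> 1%R) f))%E) ->
  inA mu q f -> measurable_fun setT V -> measurable_fun setT W ->
  (forall x, W x <= V x) -> (forall x, W x <= b) ->
  (forall x y, 0 < q x y -> `|W x - W y| <= k * Num.min 1 (d x y)) ->
  energy mu q (fun x => expR (V x)) f = Ev%:E ->
  wint2 mu (fun x => expR (V x)) f = A%:E ->
  (\int[mu]_x (`|f x| * expR (V x / 2))%:E)%E = D%:E ->
  (wint2 mu (fun x => expR (W x)) f <=
   (r * (2 * expR k * Ev + expR k * k ^+ 2 / 2 * L * A) + br * D ^+ 2)%:E)%E.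
Proof.
move=> bd mq q0 k0 L0 r0 br0 jump spi fA mV mW WV Wb Wd EvE AE DE.
have [mf _ _] := fA.
set g := fun x => f x * expR (W x / 2).
have gA : inA mu q g
  by exact: (inA_mul_expR_half _ _ _ _ _ _ _ _ _ _ _ bd mq q0 k0 L0 jump fA mW Wb Wd).
have gen := energy_expR_half_le _ _ _ _ _ _ _ _ _ _ _
  bd mq q0 k0 L0 jump mf mV mW WV Wd.
have gen0 : (0 <= energy mu q (fun=> 1%R) g)%E.
  by apply: integral_ge0 => x _; rewrite mule1 Gamma_ge0.
move: gen; rewrite EvE AE -!EFinM -EFinD -/g => gen.
(* [form_closure] takes a real value of the form, so the energy of [g] must first be seen to be
   finite. *)
have [e ee] : exists e, energy mu q (fun=> 1%R) g = e%:E.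
  exists (fine (energy mu q (fun=> 1%R) g)); rewrite fineK// ge0_fin_numE//.
  exact: le_lt_trans gen (ltry _).
move: gen; rewrite ee lee_fin => gen.
have := spi g e (form_closure_cst _ _ _ _ _ _ _ mq q0 gA ee).
have -> : wint2 mu (fun=> 1%R) g = wint2 mu (fun x => expR (W x)) f.
  apply: eq_integral => x _; rewrite mulr1 /g exprMn; congr (_ * _)%:E.
  by rewrite expr2 -expRD; congr expR; lra.
move=> /le_trans; apply; rewrite EFinD; apply: leeD.
  by rewrite lee_fin ler_wpM2l.
have w0 : (0 <= wint1 mu (fun=> 1%R) g)%E.
  by apply: integral_ge0 => x _; rewrite lee_fin mulr1.
have meV2 : measurable_fun setT (fun x => expR (V x / 2)).
  by apply: measurableT_comp => //; exact: measurable_funM.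
have mg : measurable_fun setT g by case: gA.
have wD : (wint1 mu (fun=> 1%R) g <= D%:E)%E.
  rewrite -DE; apply: ge0_le_integral => //.
  - exact: (measurable_weighted_integrands _ _ _ _ _ mg (measurable_cst _)).2.
  - exact: (measurable_weighted_integrands _ _ _ _ _ mf meV2).2.
  move=> x _; rewrite lee_fin mulr1 /g normrM (ger0_norm (expR_ge0 _)).
  by rewrite ler_wpM2l// ler_expR ler_pM2r.
by rewrite EFinM lee_wpmul2l// expr2 EFinM lee_pmul.
Qed.

(** Monotone convergence along [W n = min (V, n)], the right side being the same for all [n]. *)
Lemma wint2_expR_le (R : realType) (dm : measure_display)
    (E : measurableType dm) (d : E -> E -> R) (mu : probability E R)
    (q : E -> E -> R) (f V : E -> R) (k L r br Ev A D : R) :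
  polish_borel d -> measurable_fun setT (fun p : E * E => q p.1 p.2) ->
  (forall x y, 0 <= q x y) -> 0 <= k -> 0 <= L -> 0 <= r -> 0 <= br ->
  (forall x, \int[mu]_y (Num.min 1 (d x y ^+ 2) * q x y)%:E <= L%:E)%E ->
  (forall (f : E -> R) (e : R), form_closure mu q (fun=> 1%R) f e ->
     (wint2 mu (fun=> 1%R) f <= (r * e)%:E
        + br%:E * (wint1 mu (fun=> 1%R) f * wint1 mu (fun=> 1%R) f))%E) ->
  inA mu q f -> measurable_fun setT V ->
  (forall x y, 0 < q x y -> `|V x - V y| <= k * Num.min 1 (d x y)) ->
  energy mu q (fun x => expR (V x)) f = Ev%:E ->
  wint2 mu (fun x => expR (V x)) f = A%:E ->
  (\int[mu]_x (`|f x| * expR (V x / 2))%:E)%E = D%:E ->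
  A <= r * (2 * expR k * Ev + expR k * k ^+ 2 / 2 * L * A) + br * D ^+ 2.
Proof.
move=> bd mq q0 k0 L0 r0 br0 jump spi fA mV Vd EvE AE DE.
have [mf _ _] := fA.
pose W n x := Num.min (V x) n%:R.
have mW n : measurable_fun setT (W n) by exact: measurable_minr.
have meW n : measurable_fun setT (fun x => expR (W n x)) by exact: measurableT_comp.
have WV n x : W n x <= V x by rewrite ge_min lexx.
have Wb n x : W n x <= n%:R by rewrite ge_min lexx orbT.
(* Truncation at level [n] is 1-Lipschitz, so it does not enlarge increments. *)
have Wd n x y : 0 < q x y -> `|W n x - W n y| <= k * Num.min 1 (d x y).
  move=> /Vd; apply: le_trans; rewrite ler_norml /W.
  have := ler_norm (V x - V y); have := ler_norm (V y - V x).
  by rewrite distrC; case: (leP (V x)); case: (leP (V y)); lra.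
pose F n x : \bar R := (f x ^+ 2 * expR (W n x))%:E.
have Fle n := wint2_expR_trunc_le _ _ _ _ _ _ _ _ _ _ _ _ _ _ _ _ _ bd mq q0 k0 L0 r0 br0 jump spi
  fA mV (mW n) (WV n) (Wb n) (Wd n) EvE AE DE.
(* For fixed [x] the sequence is constant once [n >= V x]. *)
have limF x : limn (F^~ x) = (f x ^+ 2 * expR (V x))%:E.
  apply/cvg_lim => //; apply: cvg_near_cst; near=> n.
  by rewrite /F /W min_l//; near: n; exact: nbhs_infty_ger.
rewrite -lee_fin -AE /wint2; under eq_integral do rewrite -limF.
rewrite monotone_convergence//; first last.
- move=> x _ n m nm; rewrite lee_fin ler_wpM2l ?sqr_ge0// ler_expR.
  by rewrite le_min WV/= (le_trans (Wb n x))// ler_nat.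
- by move=> n x _; rewrite lee_fin mulr_ge0 ?sqr_ge0.
- by move=> n; exact: (measurable_weighted_integrands _ _ _ _ _ mf (meW n)).1.
apply: lime_le; last by apply: nearW => n; exact: Fle.
apply: ereal_nondecreasing_is_cvgn => n m nm; apply: ge0_le_integral => //.
- by move=> x _; rewrite lee_fin mulr_ge0 ?sqr_ge0.
- exact: (measurable_weighted_integrands _ _ _ _ _ mf (meW n)).1.
- exact: (measurable_weighted_integrands _ _ _ _ _ mf (meW m)).1.
move=> x _; rewrite lee_fin ler_wpM2l ?sqr_ge0// ler_expR.
by rewrite le_min WV/= (le_trans (Wb n x))// ler_nat.
Unshelve. all: by end_near. Qed.

(** * The term [mu(|f| e^{V/2})^2] and its absorption *)

(** Put [t = e^{V/2}]. If [K t >= 1], then [|f| t <= K |f| t^2]. Otherwise Young's inequality gives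
    [|f| t <= eta / 2 f^2 t^2 + 1 / (2 eta)], and the constant may be multiplied by [(K t)^-4 >= 1],
    which brings in [e^{-2V}]. The free [eta] takes the place of Cauchy-Schwarz. *)
Lemma integral_expR_half_le (R : realType) (dm : measure_display)
    (E : measurableType dm) (mu : {measure set E -> \bar R})
    (f V : E -> R) (K eta : R) :
  0 < K -> 0 < eta -> measurable_fun setT f -> measurable_fun setT V ->
  (\int[mu]_x (`|f x| * expR (V x / 2))%:E <=
   K%:E * wint1 mu (fun x => expR (V x)) f + 1%:E *
   ((eta / 2)%:E * wint2 mu (fun x => expR (V x)) f +
   ((2 * eta * K ^+ 4)^-1)%:E * \int[mu]_x (expR (-2 * V x))%:E))%E.
Proof.
move=> K0 eta0 mf mV.
have meV : measurable_fun setT (fun x => expR (V x)) by exact: measurableT_comp.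
have meV2 : measurable_fun setT (fun x => expR (V x / 2)).
  by apply: measurableT_comp => //; exact: measurable_funM.
have me2V : measurable_fun setT (fun x => (expR (-2 * V x))%:E).
  apply/measurable_EFinP.
  by apply: measurableT_comp => //; exact: measurable_funM.
have [m2 m1] := measurable_weighted_integrands _ _ _ _ _ mf meV.
have [_ m12] := measurable_weighted_integrands _ _ _ _ _ mf meV2.
have p2 x : (0 <= (f x ^+ 2 * expR (V x))%:E)%E.
  by rewrite lee_fin mulr_ge0 ?sqr_ge0.
have p1 x : (0 <= (`|f x| * expR (V x))%:E)%E by rewrite lee_fin mulr_ge0.
have p12 x : (0 <= (`|f x| * expR (V x / 2))%:E)%E by rewrite lee_fin mulr_ge0.
have p2V x : (0 <= (expR (-2 * V x))%:E)%E by rewrite lee_fin.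
have e20 : 0 <= eta / 2 by lra.
have c0 : 0 <= (2 * eta * K ^+ 4)^-1.
  by rewrite invr_ge0 !mulr_ge0// ltW.
rewrite -[((eta / 2)%:E * _)%E]ge0_integralZl_EFin//.
rewrite -[((_ ^-1)%:E * _)%E]ge0_integralZl_EFin//.
rewrite -[(integral _ _ _ + integral _ _ _)%E]ge0_integralD//; last 4 first.
- by move=> x _; rewrite mule_ge0.
- exact: measurable_funeM.
- by move=> x _; rewrite mule_ge0.
- exact: measurable_funeM.
apply: le_integral_lincomb => //.
- by apply: emeasurable_funD; exact: measurable_funeM.
- by move=> x; rewrite adde_ge0// mule_ge0.
- exact: ltW.
move=> x; rewrite mul1e -!EFinM -!EFinD lee_fin.
have t0 := expR_gt0 (V x / 2); set t := expR (V x / 2) in t0 *.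
have -> : expR (V x) = t ^+ 2 by rewrite /t expr2 -expRD; congr expR; lra.
have -> : expR (-2 * V x) = t ^- 4.
  by rewrite /t -expRM_natl -expRN; congr expR; lra.
set a := `|f x|; have a0 : 0 <= a by exact: normr_ge0.
have -> : f x ^+ 2 = a ^+ 2 by rewrite /a real_normK ?num_real.
have [Kt|Kt] := leP 1 (K * t).
  have h1 : a * t <= K * (a * t ^+ 2).
    have -> : K * (a * t ^+ 2) = (a * t) * (K * t) by ring.
    by rewrite ler_peMr// mulr_ge0// ltW.
  rewrite -[leLHS]addr0 lerD// addr_ge0// mulr_ge0//.
  - by rewrite mulr_ge0 ?sqr_ge0.
  - by rewrite invr_ge0 exprn_ge0 ?ltW.
have h2 : 1 <= (K * t) ^- 4.
  by rewrite invr_ge1 ?unitfE ?gt_eqF ?exprn_gt0 ?mulr_gt0// exprn_ile1 ?ltW ?mulr_gt0.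
have -> : (2 * eta * K ^+ 4)^-1 * t ^- 4 = (2 * eta)^-1 * (K * t) ^- 4.
  by field; rewrite !gt_eqF.
have h3 : (2 * eta)^-1 <= (2 * eta)^-1 * (K * t) ^- 4.
  by rewrite ler_peMr// invr_ge0 mulr_ge0// ltW.
have h4 : a * t <= eta / 2 * (a ^+ 2 * t ^+ 2) + (2 * eta)^-1.
  have -> : eta / 2 * (a ^+ 2 * t ^+ 2) + (2 * eta)^-1 =
      a * t + (2 * eta)^-1 * (eta * (a * t) - 1) ^+ 2.
    by field; rewrite gt_eqF.
  by rewrite lerDl mulr_ge0 ?sqr_ge0// invr_ge0 mulr_ge0// ltW.
have h5 : 0 <= K * (a * t ^+ 2) by rewrite (mulr_ge0 (ltW K0))// mulr_ge0 ?sqr_ge0.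
lra.
Qed.

(* The optimal [eta] is [(D - B) / A]. *)
Lemma sqr_le_of_forall_amgm (R : realFieldType) (D B A c : R) :
  0 <= D -> 0 < A -> 0 <= c ->
  (forall eta, 0 < eta -> D <= B + (eta / 2 * A + (2 * eta)^-1 * c)) ->
  D ^+ 2 <= 2 * B ^+ 2 + 2 * A * c.
Proof.
move=> D0 A0 c0 h.
have [DB|BD] := leP D B.
  have : D ^+ 2 <= B ^+ 2 by rewrite ler_sqr ?nnegrE// (le_trans D0).
  have := sqr_ge0 B; have : 0 <= A * c by rewrite mulr_ge0// ltW.
  lra.
set X := D - B; have X0 : 0 < X by rewrite /X subr_gt0.
have := h (X / A) (divr_gt0 X0 A0).
have -> : X / A / 2 * A = X / 2 by field; rewrite gt_eqF.
have -> : (2 * (X / A))^-1 * c = A * c / (2 * X) by field; rewrite !gt_eqF.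
move=> hX; have : X / 2 <= A * c / (2 * X) by rewrite /X in hX *; lra.
rewrite ler_pdivlMr ?mulr_gt0// => hX2.
have -> : D = B + X by rewrite /X; lra.
have := sqr_ge0 (B - X); nra.
Qed.

(** The real algebra of the proof: [A], [Ev], [B], [D] are to be [mu_V(f^2)], [E_V(f)], [mu_V(|f|)],
    [mu(|f| e^{V/2})], and [b], [c] are [beta(r)], [kappa2]. *)
Lemma super_poincare_absorb (R : realType) (A Ev B D b c k L r s : R) :
  0 <= A -> 0 <= Ev -> 0 <= B -> 0 <= D -> 1 <= b -> 1 <= c -> 0 <= k -> 0 <= L ->
  0 < s -> 0 < r <= s * expR (- k) / (4 + L * k ^+ 2 * s) ->
  A <= r * (2 * expR k * Ev + expR k * k ^+ 2 / 2 * L * A) + b * D ^+ 2 ->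
  (0 < A -> forall K, 0 < K -> D ^+ 2 <= 2 * (K * B) ^+ 2 + 2 * A * (c / K ^+ 4)) ->
  A <= s * Ev + 16 * c * b ^+ 3 * (4 + L * k ^+ 2 * s) * B ^+ 2.
Proof.
move=> A0 Ev0 B0 D0 b1 c1 k0 L0 s0 /andP[r0 rle] Ale Dle.
set T := 4 + _ in rle *.
have LK : 0 <= L * k ^+ 2 by rewrite mulr_ge0 ?sqr_ge0.
have T4 : 4 <= T by rewrite lerDl mulr_ge0// ltW.
have cb : 1 <= c * b ^+ 2 by rewrite -[1]mulr1 ler_pM ?exprn_ege1.
have [A_gt0|A_le0] := ltP 0 A; last first.
  apply: (le_trans A_le0); rewrite addr_ge0 ?mulr_ge0 ?sqr_ge0 ?exprn_ge0//; lra.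
have bc0 : 0 < 2 * b * c by rewrite !mulr_gt0//; lra.
(* With [K^2 = 2 b c] the last term of [b D^2] becomes [A / (2 b c)], which is at most [A / 2]. *)
have := Dle A_gt0 (Num.sqrt (2 * b * c)); rewrite sqrtr_gt0 => /(_ bc0).
have -> : Num.sqrt (2 * b * c) ^+ 4 = (2 * b * c) ^+ 2.
  by rewrite (exprM _ 2 2) sqr_sqrtr// ltW.
rewrite exprMn (sqr_sqrtr (ltW bc0)) => hD.
have bD : b * D ^+ 2 <= 4 * (b ^+ 2 * c) * B ^+ 2 + A / 2.
  have -> : 4 * (b ^+ 2 * c) * B ^+ 2 + A / 2 =
     b * (2 * (2 * b * c * B ^+ 2) + A / (2 * b)) by field; rewrite gt_eqF//; lra.
  rewrite ler_pM2l; last lra.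
  apply: (le_trans hD); rewrite lerD2l.
  have -> : 2 * A * (c / (2 * b * c) ^+ 2) = (A / (2 * b)) * (b * c)^-1.
    by field; apply/andP; split; rewrite gt_eqF//; lra.
  rewrite ler_piMr ?divr_ge0//; first lra.
  by rewrite invf_le1 ?mulr_gt0//; [rewrite -[1]mulr1 ler_pM|lra|lra].
(* The upper bound on [r] says exactly that [rho T <= s]. *)
set rho := r * expR k.
have rT : rho * T <= s.
  rewrite /rho; move: rle; rewrite ler_pdivlMr; last lra.
  rewrite expRN => h; have ek := expR_gt0 k.
  have : r * T * expR k <= s / expR k * expR k by rewrite ler_pM2r.
  by rewrite divfK ?gt_eqF// mulrAC.
have TA : T * A <= 2 * (rho * T) * Ev + (rho * T) * (L * k ^+ 2) / 2 * A +
    T * (4 * (b ^+ 2 * c) * B ^+ 2) + T * A / 2.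
  have : T * A <= T * (r * (2 * expR k * Ev + expR k * k ^+ 2 / 2 * L * A) +
      (4 * (b ^+ 2 * c) * B ^+ 2 + A / 2)) by rewrite ler_pM2l; lra.
  by rewrite /rho; lra.
have h1 : (rho * T) * Ev <= s * Ev by rewrite ler_wpM2r.
have h2 : (rho * T) * (L * k ^+ 2 * A) <= s * (L * k ^+ 2 * A).
  by rewrite ler_wpM2r// mulr_ge0.
(* Since [T - L k^2 s = 4], collecting the terms in [A] leaves [2 A] on the left. *)
have h3 : A <= s * Ev + 2 * (T * (b ^+ 2 * c * B ^+ 2)).
  by move: TA h1 h2; rewrite /T; lra.
apply: (le_trans h3); rewrite lerD2l.
(* The constant reached is [2 c b^2 T]; [b >= 1] brings it below [16 c b^3 T]. *)
have h4 : T * (b ^+ 2 * c * B ^+ 2) <= b * (T * (b ^+ 2 * c * B ^+ 2)).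
  by rewrite ler_peMl// !mulr_ge0 ?sqr_ge0//; lra.
have h5 : 0 <= T * (b ^+ 2 * c * B ^+ 2) by rewrite !mulr_ge0 ?sqr_ge0//; lra.
have -> : 16 * c * b ^+ 3 * T * B ^+ 2 = 16 * (b * (T * (b ^+ 2 * c * B ^+ 2))) by ring.
lra.
Qed.

(** * Extension from [A] to the closed form *)

(** Integrate [|h| <= t / 2 + h^2 / (2 t)] against the probability [w mu]. Taking [t = 1] yields
    finiteness; if [wint2] is at most [t^2], then [wint1] is at most [t]. *)
Lemma wint1_le_wint2 (R : realType) (dm : measure_display)
    (E : measurableType dm) (mu : {measure set E -> \bar R}) (w h : E -> R) (t : R) :
  0 < t -> measurable_fun setT h -> measurable_fun setT w -> (forall x, 0 <= w x) ->
  (\int[mu]_x (w x)%:E = 1)%E ->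
  (wint1 mu w h <= (t / 2)%:E + (2 * t)^-1%:E * wint2 mu w h)%E.
Proof.
move=> t0 mh mw w0 w1.
have [m2 m1] := measurable_weighted_integrands _ _ _ _ _ mh mw.
rewrite -[X in (X + _)%E]mule1 -w1; apply: le_integral_lincomb => //.
- exact/measurable_EFinP.
- by move=> x; rewrite lee_fin mulr_ge0.
- by move=> x; rewrite lee_fin mulr_ge0 ?sqr_ge0.
- by rewrite divr_ge0// ltW.
- by rewrite invr_ge0 mulr_ge0// ltW.
move=> x; rewrite -!EFinM -EFinD lee_fin mulrA -mulrDl ler_wpM2r//.
rewrite -[h x ^+ 2]real_normK ?num_real//.
have -> : t / 2 + (2 * t)^-1 * `|h x| ^+ 2 = `|h x| + (2 * t)^-1 * (`|h x| - t) ^+ 2.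
  by field; rewrite gt_eqF.
by rewrite lerDl mulr_ge0 ?sqr_ge0// invr_ge0 mulr_ge0// ltW.
Qed.

(** The inequality for an approximant at distance [t] carries over to [f] with an error of order
    [t]. The integrals are returned as reals so that an infimum over constants [b] can be taken
    afterwards. *)
Lemma form_closure_super_poincare (R : realType) (dm : measure_display)
    (E : measurableType dm) (mu : {measure set E -> \bar R}) (q : E -> E -> R)
    (w : E -> R) (s b : R) :
  0 <= s -> 0 <= b -> measurable_fun setT w -> (forall x, 0 <= w x) ->
  (\int[mu]_x (w x)%:E = 1)%E ->
  (forall u, inA mu q u -> (wint2 mu w u <=
     s%:E * energy mu q w u + b%:E * (wint1 mu w u * wint1 mu w u))%E) ->
  forall f e, form_closure mu q w f e -> exists A B : R,
    [/\ wint2 mu w f = A%:E, wint1 mu w f = B%:E, 0 <= B &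
        A <= s * e + b * B ^+ 2].
Proof.
move=> s0 b0 mw w0 w1 spi f e [mf f2 [u [uA uf _ ue]]].
have p2 h : (0 <= wint2 mu w h)%E.
  by apply: integral_ge0 => x _; rewrite lee_fin mulr_ge0 ?sqr_ge0.
have p1 h : (0 <= wint1 mu w h)%E.
  by apply: integral_ge0 => x _; rewrite lee_fin mulr_ge0.
have [A fA] : exists A, wint2 mu w f = A%:E.
  by exists (fine (wint2 mu w f)); rewrite fineK// ge0_fin_numE.
have [B fB] : exists B, wint1 mu w f = B%:E.
  exists (fine (wint1 mu w f)); rewrite fineK// ge0_fin_numE//.
  apply: le_lt_trans (wint1_le_wint2 _ _ _ _ _ _ _ ltr01 mf mw w0 w1) _.
  by rewrite fA -EFinM -EFinD ltry.
have B0 : 0 <= B by rewrite -lee_fin -fB.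
exists A, B; split => //.
set X := s * e + b * B ^+ 2; set Z := s + 2 * b * B + b.
have Z0 : 0 <= Z by rewrite !addr_ge0// !mulr_ge0.
have step t : 0 < t -> t <= 1 -> A <= X + t * (`|X| + 2 * Z + 2).
  move=> t0 t1.
  (* The squared distance is taken at most [t^2] because it gets multiplied by [1 + 1/t]. *)
  have [N1 /(_ _ (leq_maxl _ _)) hN1] := uf _ (exprn_gt0 2 t0).
  have [N2 /(_ _ (leq_maxr _ _)) hN2] := ue _ t0.
  move: (hN1 N2) (hN2 N1).2 => {hN1 hN2}.
  set v := u (maxn N1 N2); have vA : inA mu q v by exact: uA.
  have mv : measurable_fun setT v by case: vA.
  have mvf : measurable_fun setT (v \- f)%R by exact: measurable_funB.
  have [m2v m1v] := measurable_weighted_integrands _ _ _ _ _ mv mw.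
  have [m2f m1f] := measurable_weighted_integrands _ _ _ _ _ mf mw.
  have [m2vf m1vf] := measurable_weighted_integrands _ _ _ _ _ mvf mw.
  move=> vf ve.
  have vf1 : (wint1 mu w (v \- f)%R <= t%:E)%E.
    apply: (le_trans (wint1_le_wint2 _ _ _ _ _ _ _ t0 mvf mw w0 w1)).
    have -> : t%:E = ((t / 2)%:E + (2 * t)^-1%:E * (t ^+ 2)%:E)%E.
      by rewrite -EFinM -EFinD; congr EFin; field; rewrite gt_eqF.
    by rewrite leeD2l// lee_wpmul2l// lee_fin invr_ge0 mulr_ge0// ltW.
  have v1 : (wint1 mu w v <= (B + t)%:E)%E.
    apply: (@le_trans _ _ (1%:E * wint1 mu w f + 1%:E * wint1 mu w (v \- f)%R)%E).
      apply: le_integral_lincomb => //.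
      - by move=> x; rewrite lee_fin mulr_ge0.
      - by move=> x; rewrite lee_fin mulr_ge0.
      - by move=> x; rewrite lee_fin mulr_ge0.
      move=> x; rewrite !mul1e -EFinD lee_fin -mulrDl ler_wpM2r//=.
      by rewrite (le_trans _ (ler_normD _ _))// addrC subrK.
    by rewrite !mul1e fB EFinD leeD2l.
  have v2 : (wint2 mu w v <= (s * (e + t) + b * (B + t) ^+ 2)%:E)%E.
    apply: (le_trans (spi _ vA)); rewrite EFinD; apply: leeD.
      by rewrite EFinM lee_wpmul2l.
    by rewrite EFinM expr2 EFinM lee_wpmul2l// lee_pmul.
  (* Young's inequality for [f = v - (v - f)], with weights that keep the coefficient of [v^2] close
     to 1. *)
  have Av : (A%:E <= (1 + t)%:E * wint2 mu w v +
                     (1 + t^-1)%:E * wint2 mu w (v \- f)%R)%E.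
    rewrite -fA; apply: le_integral_lincomb => //.
    - by move=> x; rewrite lee_fin mulr_ge0 ?sqr_ge0.
    - by move=> x; rewrite lee_fin mulr_ge0 ?sqr_ge0.
    - by move=> x; rewrite lee_fin mulr_ge0 ?sqr_ge0.
    - by rewrite addr_ge0// ltW.
    - by rewrite addr_ge0// invr_ge0 ltW.
    move=> x; rewrite -!EFinM -EFinD lee_fin (mulrA (1 + t)) (mulrA (1 + t^-1)) -mulrDl ler_wpM2r//=.
    have -> : (1 + t) * v x ^+ 2 + (1 + t^-1) * (v x - f x) ^+ 2 =
        f x ^+ 2 + t^-1 * (t * v x + (v x - f x)) ^+ 2.
      by field; rewrite gt_eqF.
    by rewrite lerDl mulr_ge0 ?sqr_ge0// invr_ge0 ltW.
  have : A <= (1 + t) * (s * (e + t) + b * (B + t) ^+ 2) + (1 + t^-1) * t ^+ 2.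
    rewrite -lee_fin (le_trans Av)// [leRHS]EFinD; apply: leeD.
      by rewrite [leRHS]EFinM lee_wpmul2l// lee_fin addr_ge0// ltW.
    by rewrite [leRHS]EFinM lee_wpmul2l// lee_fin addr_ge0// invr_ge0 ltW.
  have -> : (1 + t^-1) * t ^+ 2 = t ^+ 2 + t by field; rewrite gt_eqF.
  have -> : s * (e + t) + b * (B + t) ^+ 2 = X + t * (s + 2 * b * B + b * t).
    by rewrite /X; ring.
  (* From here on [t <= 1] turns every higher power of [t] into [t]. *)
  have : X + t * (s + 2 * b * B + b * t) <= X + t * Z.
    by rewrite lerD2l ler_pM2l// lerD2l ler_piMr.
  have XX := ler_norm X.
  have tX : t * X <= t * `|X| by rewrite ler_pM2l.
  have tt : t ^+ 2 <= t by rewrite expr2 ler_piMr// ltW.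
  have ttZ : t ^+ 2 * Z <= t * Z by rewrite ler_wpM2r.
  set Y := X + t * (_ + _) => YZ AY.
  have : (1 + t) * Y <= (1 + t) * (X + t * Z) by rewrite ler_pM2l//; lra.
  by move=> ?; lra.
apply/ler_addgt0Pr => eps eps0.
have C0 : 0 < `|X| + 2 * Z + 2 by have := normr_ge0 X; lra.
set C := _ + 2 in step C0.
(* This choice makes the error [t C] at most [eps] while keeping [t <= 1]. *)
have t0 : 0 < Num.min 1 (eps / C) by rewrite lt_min ltr01 divr_gt0.
apply: (le_trans (step _ t0 _)); first by rewrite ge_min lexx.
by rewrite lerD2l -ler_pdivlMr// ge_min lexx orbT.
Qed.

(** * Lower bounds on [beta] and [kappa2]; finiteness on [A] *)

(** Constants carry no energy, and [mu] has mass 1. *)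
Lemma beta_ge1 (R : realType) (dm : measure_display) (E : measurableType dm)
    (mu : probability E R) (q : E -> E -> R) (r b : R) :
  measurable_fun setT (fun p : E * E => q p.1 p.2) -> (forall x y, 0 <= q x y) ->
  (forall (f : E -> R) (e : R), form_closure mu q (fun=> 1%R) f e ->
     (wint2 mu (fun=> 1%R) f <= (r * e)%:E
        + b%:E * (wint1 mu (fun=> 1%R) f * wint1 mu (fun=> 1%R) f))%E) ->
  1 <= b.
Proof.
move=> mq q0 spi.
have G0 x : Gamma mu q (fun=> 1%R) x = 0%E.
  by apply: integral0_eq => y _; rewrite subrr expr0n mul0r.
have A1 : inA mu q (fun=> 1%R).
  split => //; first by exists 1 => x; rewrite normr1.
  by exists 0 => x; rewrite G0.
have e0 : energy mu q (fun=> 1%R) (fun=> 1%R) = 0%:E.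
  by apply: integral0_eq => x _; rewrite G0 mul0e.
have := spi _ _ (form_closure_cst _ _ _ _ _ _ _ mq q0 A1 e0).
rewrite /wint1 /wint2 expr1n normr1 !mulr1 probability_integral_cst.
by rewrite mulr0 add0e !mule1 lee_fin.
Qed.

(** The tangent line of [t^-2] at [t = 1] gives [3 <= 2 t + t^-2]; integrate it at [t = e^V], whose
    integral is 1. *)
Lemma integral_expRN2_ge1 (R : realType) (dm : measure_display)
    (E : measurableType dm) (mu : probability E R) (V : E -> R) :
  measurable_fun setT V -> (\int[mu]_x (expR (V x))%:E = 1)%E ->
  (1 <= \int[mu]_x (expR (-2 * V x))%:E)%E.
Proof.
move=> mV V1.
have : (\int[mu]_x 3%:E <= 2%:E * \int[mu]_x (expR (V x))%:E
    + 1%:E * \int[mu]_x (expR (-2 * V x))%:E)%E.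
  apply: le_integral_lincomb => //.
  - by apply/measurable_EFinP; exact: measurableT_comp.
  - apply/measurable_EFinP; apply: measurableT_comp => //.
    exact: measurable_funM.
  move=> x; rewrite mul1e -EFinM -EFinD lee_fin.
  have -> : expR (-2 * V x) = expR (V x) ^- 2.
    by rewrite -expRM_natl -expRN; congr expR; lra.
  have := expR_gt0 (V x); set t := expR (V x) => t0.
  have -> : 2 * t + t ^- 2 = 3 + t ^- 2 * (t - 1) ^+ 2 * (2 * t + 1).
    by field; rewrite gt_eqF.
  rewrite lerDl mulr_ge0//; first by rewrite mulr_ge0 ?sqr_ge0// invr_ge0 sqr_ge0.
  lra.
rewrite probability_integral_cst V1 mule1 mul1e -leeBlDl//.
by rewrite -EFinB; congr (_%:E <= _)%E; lra.
Qed.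

Lemma integral_bounded_mul_lty (R : realType) (dm : measure_display)
    (E : measurableType dm) (mu : {measure set E -> \bar R}) (h : E -> \bar R)
    (w : E -> R) (M : R) :
  measurable_fun setT h -> measurable_fun setT w ->
  (forall x, 0 <= h x)%E -> (forall x, 0 <= w x) -> (forall x, h x <= M%:E)%E ->
  (\int[mu]_x (w x)%:E = 1)%E -> (\int[mu]_x (h x * (w x)%:E) < +oo)%E.
Proof.
move=> mh mw h0 w0 hM w1.
have mew : measurable_fun setT (fun x => (w x)%:E) by exact/measurable_EFinP.
apply: (@le_lt_trans _ _ (`|M|%:E * \int[mu]_x (w x)%:E)%E); last first.
  by rewrite w1 mule1 ltry.
rewrite -ge0_integralZl_EFin//; last by move=> x _; rewrite lee_fin.
apply: ge0_le_integral => //.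
- by move=> x _; rewrite mule_ge0// lee_fin.
- exact: emeasurable_funM.
- exact: measurable_funeM.
move=> x _; rewrite lee_wpmul2r// ?lee_fin//.
by rewrite (le_trans (hM x))// lee_fin ler_norm.
Qed.

(** * The weighted inequality on [A] *)

(** For [u] in [A] the energy and the three integrals are finite, so the estimates become
    inequalities between reals and the absorption applies. *)
Lemma inA_weighted_super_poincare (R : realType) (dm : measure_display)
    (E : measurableType dm) (d : E -> E -> R) (mu : probability E R)
    (q : E -> E -> R) (u V : E -> R) (k L c r b s : R) :
  polish_borel d -> measurable_fun setT (fun p : E * E => q p.1 p.2) ->
  (forall x y, 0 <= q x y) -> 0 <= k -> 0 <= L -> 0 < s ->
  (forall x, \int[mu]_y (Num.min 1 (d x y ^+ 2) * q x y)%:E <= L%:E)%E ->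
  (forall (f : E -> R) (e : R), form_closure mu q (fun=> 1%R) f e ->
     (wint2 mu (fun=> 1%R) f <= (r * e)%:E
        + b%:E * (wint1 mu (fun=> 1%R) f * wint1 mu (fun=> 1%R) f))%E) ->
  measurable_fun setT V -> (\int[mu]_x (expR (V x))%:E = 1)%E ->
  (\int[mu]_x (expR (-2 * V x))%:E = c%:E)%E ->
  (forall x y, 0 < q x y -> `|V x - V y| <= k * Num.min 1 (d x y)) ->
  0 < r <= s * expR (- k) / (4 + L * k ^+ 2 * s) ->
  inA mu q u ->
  (wint2 mu (fun x => expR (V x)) u <=
     s%:E * energy mu q (fun x => expR (V x)) u +
     (16 * c * b ^+ 3 * (4 + L * k ^+ 2 * s))%:E *
     (wint1 mu (fun x => expR (V x)) u * wint1 mu (fun x => expR (V x)) u))%E.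
Proof.
move=> bd mq q0 k0 L0 s0 jump spi mV V1 Vc Vd rs uA.
have [mu_ [M uM] [G uG]] := uA.
set w := fun x => expR (V x).
have mw : measurable_fun setT w by exact: measurableT_comp.
have w0 x : 0 <= w x by exact: expR_ge0.
have b1 : 1 <= b by exact: (beta_ge1 _ _ _ _ _ r _ mq q0 spi).
have c1 : 1 <= c by rewrite -lee_fin -Vc; exact: integral_expRN2_ge1.
have p2 : (0 <= wint2 mu w u)%E.
  by apply: integral_ge0 => x _; rewrite lee_fin mulr_ge0 ?sqr_ge0.
have p1 : (0 <= wint1 mu w u)%E.
  by apply: integral_ge0 => x _; rewrite lee_fin mulr_ge0.
have pe : (0 <= energy mu q w u)%E.
  by apply: integral_ge0 => x _; rewrite mule_ge0 ?Gamma_ge0// lee_fin.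
have pD : (0 <= \int[mu]_x (`|u x| * expR (V x / 2))%:E)%E.
  by apply: integral_ge0 => x _; rewrite lee_fin mulr_ge0.
have real (x : \bar R) : (0 <= x)%E -> (x < +oo)%E -> exists2 y, x = y%:E & 0 <= y.
  by case: x => // y y0 _; exists y.
have [Ev EvE Ev0] := real _ pe
  (integral_bounded_mul_lty _ _ _ _ _ _ _ (measurable_Gamma _ _ _ _ _ _ mq q0 mu_)
    mw (fun x => Gamma_ge0 _ _ _ _ _ _ x q0) w0 uG V1).
have [A AE A0] : exists2 A, wint2 mu w u = A%:E & 0 <= A.
  apply: real => //; rewrite /wint2; under eq_integral do rewrite EFinM.
  apply: (integral_bounded_mul_lty _ _ _ _ _ _ (M ^+ 2)) => //.
  - by apply/measurable_EFinP; exact: measurable_funX.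
  - by move=> x; rewrite lee_fin sqr_ge0.
  move=> x; rewrite lee_fin -[u x ^+ 2]real_normK ?num_real//.
  by rewrite ler_sqr ?nnegrE// (le_trans _ (uM x)).
have [B BE B0] : exists2 B, wint1 mu w u = B%:E & 0 <= B.
  apply: real => //; apply: le_lt_trans
    (wint1_le_wint2 _ _ _ _ _ _ _ ltr01 mu_ mw w0 V1) _.
  by rewrite AE -EFinM -EFinD ltry.
have Dle K eta (K0 : 0 < K) (eta0 : 0 < eta) :=
  integral_expR_half_le _ _ _ mu _ _ _ _ K0 eta0 mu_ mV.
rewrite -/w AE BE Vc in Dle.
have [D DE D0] :
    exists2 D, (\int[mu]_x (`|u x| * expR (V x / 2))%:E = D%:E)%E & 0 <= D.
  (* Any choice of [K] and [eta] shows that [D] is finite. *)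
  apply: real => //; apply: le_lt_trans (Dle 1 1 ltr01 ltr01) _.
  by rewrite !mul1e -!EFinM -!EFinD ltry.
rewrite AE EvE BE -!EFinM -EFinD lee_fin -expr2.
have r0 : 0 <= r by move: rs => /andP[/ltW].
apply: (super_poincare_absorb _ _ _ _ D _ _ _ _ r) => //.
  apply: (wint2_expR_le _ _ _ _ _ _ _ _ _ _ _ _ _ _ _ bd mq q0 k0 L0 r0 _ jump
    spi uA mV Vd EvE AE DE).
  exact: le_trans b1.
(* For each [K] the parameter [eta] is optimised away, with constant [kappa2 / K^4]. *)
move=> A_gt0 K K0; apply: sqr_le_of_forall_amgm => //.
  by rewrite divr_ge0 ?exprn_ge0// ?(le_trans _ c1)// ltW.
move=> eta eta0; have := Dle K eta K0 eta0.
rewrite DE mul1e -!EFinM -!EFinD lee_fin.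
suff -> : (2 * eta)^-1 * (c / K ^+ 4) = (2 * eta * K ^+ 4)^-1 * c by [].
by field; rewrite !gt_eqF.
Qed.

(** * Passage to the infimum over admissible pairs *)

Theorem theorem2p9 (R : realType) (dm : measure_display) (E : measurableType dm)
    (d : E -> E -> R) (mu : probability E R) (q : E -> E -> R) (o : E) (V : E -> R)
    (beta : R -> R) (kappa1 : R) :
  polish_borel d ->
  measurable_fun setT (fun p : E * E => q p.1 p.2) ->
  (forall x y, 0 <= q x y) ->
  (forall x, q x x = 0) ->
  (jump_lambda mu d q < +oo)%E ->
  (* A is dense in L^2(mu) *)
  (forall f : E -> R, measurable_fun setT f -> (wint2 mu (fun=> 1%R) f < +oo)%E ->
     forall eps : R, 0 < eps -> exists2 g, inA mu q g &
       (wint2 mu (fun=> 1%R) (g \- f)%R <= eps%:E)%E) ->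
  (* V *)
  measurable_fun setT V ->
  (forall r : R, 0 < r -> exists M : R, forall x, d o x <= r -> `|V x| <= M) ->
  (\int[mu]_x (expR (V x))%:E)%E = 1%E ->
  (* super Poincare inequality for (E, D(E)) *)
  (forall r : R, 0 < r -> 0 < beta r) ->
  (forall r1 r2 : R, 0 < r1 -> r1 <= r2 -> beta r2 <= beta r1) ->
  (forall r : R, 0 < r -> forall (f : E -> R) (e : R),
     form_closure mu q (fun=> 1%R) f e ->
     (wint2 mu (fun=> 1%R) f <= (r * e)%:E
        + (beta r)%:E * (wint1 mu (fun=> 1%R) f * wint1 mu (fun=> 1%R) f))%E) ->
  (* conditions on V *)
  0 < kappa1 ->
  (\int[mu]_x (expR (-2 * V x))%:E < +oo)%E ->
  (forall x y, 0 < q x y -> `|V x - V y| <= kappa1 * Num.min 1 (d x y)) ->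
  (* conclusion: super Poincare inequality for (E_V, D(E_V)) *)
  forall s : R, 0 < s -> forall (f : E -> R) (e : R),
    form_closure mu q (fun x => expR (V x)) f e ->
    (wint2 mu (fun x => expR (V x)) f <= (s * e)%:E
       + (betaV beta kappa1 (fine (\int[mu]_x (expR (-2 * V x))%:E))
                (fine (jump_lambda mu d q)) s)%:E
         * (wint1 mu (fun x => expR (V x)) f * wint1 mu (fun x => expR (V x)) f))%E.
Proof.
move=> bd mq q0 _ lam _ mV _ V1 b0 _ spi k0 Vc Vd s s0 f e fe.
set kappa2 := fine _; set lambda := fine _.
have lam0 : (0 <= jump_lambda mu d q)%E.
  apply: (@le_trans _ _ (\int[mu]_y (Num.min 1 (d o y ^+ 2) * q o y)%:E)%E).
    apply: integral_ge0 => y _.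
    by rewrite lee_fin mulr_ge0// le_min ler01 sqr_ge0.
  by apply: ereal_sup_ubound; exists o.
have jump x : (\int[mu]_y (Num.min 1 (d x y ^+ 2) * q x y)%:E <= lambda%:E)%E.
  rewrite /lambda fineK; last by rewrite ge0_fin_numE.
  by apply: ereal_sup_ubound; exists x.
have L0 : 0 <= lambda by exact: fine_ge0.
have c1 := integral_expRN2_ge1 _ _ _ _ _ mV V1.
have cE : (\int[mu]_x (expR (-2 * V x))%:E)%E = kappa2%:E.
  by rewrite fineK// ge0_fin_numE// (le_trans _ c1).
have c0 : 0 <= kappa2 by rewrite -lee_fin -cE (le_trans _ c1).
have den0 t : 0 < t -> 0 < 4 + lambda * kappa1 ^+ 2 * t.
  by move=> t0; rewrite ltr_pwDl// !mulr_ge0 ?sqr_ge0// ltW.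
(* For one admissible pair, the inequality on [A] holds with [s'], is weakened to [s], and is then
   carried to the closed form. *)
have key s' r : 0 < s' <= s ->
    0 < r <= s' * expR (- kappa1) / (4 + lambda * kappa1 ^+ 2 * s') ->
    exists A B : R, [/\ wint2 mu (fun x => expR (V x)) f = A%:E,
      wint1 mu (fun x => expR (V x)) f = B%:E, 0 <= B &
      A <= s * e + 16 * kappa2 * beta r ^+ 3 *
                   (4 + lambda * kappa1 ^+ 2 * s') * B ^+ 2].
  move=> /andP[s'0 s's] rs'; have r0 : 0 < r by case/andP: rs'.
  apply: (form_closure_super_poincare _ _ _ _ _ _ _ _ _ _ _ _ V1 _ _ _ fe).
  - exact: ltW.
  - rewrite mulr_ge0 ?(ltW (den0 _ s'0))// mulr_ge0 ?exprn_ge0 ?(ltW (b0 _ r0))//.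
    by rewrite mulr_ge0.
  - exact: measurableT_comp.
  - by move=> x; exact: expR_ge0.
  move=> u uA.
  apply: (le_trans (inA_weighted_super_poincare _ _ _ _ _ _ _ _ _ _ _ _ _ _
    bd mq q0 (ltW k0) L0 s'0 jump (spi r r0) mV V1 cE Vd rs' uA)).
  rewrite leeD2r// lee_wpmul2r ?lee_fin//.
  by apply: integral_ge0 => x _; rewrite mule_ge0 ?Gamma_ge0// lee_fin expR_ge0.
set S := [set y : R | exists s' r : R,
        [/\ 0 < s' <= s,
            0 < r <= s' * expR (- kappa1) / (4 + lambda * kappa1 ^+ 2 * s') &
            y = 16 * kappa2 * beta r ^+ 3 * (4 + lambda * kappa1 ^+ 2 * s')]].
(* The pair with [s' = s] and the largest [r] shows that [S] is nonempty, without which a real [inf]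
   would be a default value. *)
pose r1 := s * expR (- kappa1) / (4 + lambda * kappa1 ^+ 2 * s).
have s0s : 0 < s <= s by rewrite s0 lexx.
have r1r : 0 < r1 <= r1 by rewrite lexx divr_gt0 ?den0// mulr_gt0 ?expR_gt0.
have S0 : S !=set0.
  by exists (16 * kappa2 * beta r1 ^+ 3 * (4 + lambda * kappa1 ^+ 2 * s)), s, r1.
have [A [B [AE BE B0 _]]] := key s r1 s0s r1r.
(* [A] and [B] are the integrals themselves, hence the same for every admissible pair. *)
have keyS y : S y -> A <= s * e + y * B ^+ 2.
  move=> [s' [r [hs hr ->]]]; have [A' [B' []]] := key s' r hs hr.
  by rewrite AE BE => -[->] [->] _.
rewrite AE BE -!EFinM -EFinD lee_fin -expr2.
rewrite -[betaV _ _ _ _ _]/(inf S).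
(* If [B > 0], then [(A - s e) / B^2] is a lower bound of [S], hence at most [inf S]; if [B = 0],
   one element of [S] suffices. *)
have [B_gt0|B_le0] := ltP 0 B; last first.
  have [y Sy] := S0; have := keyS y Sy.
  have -> : B = 0 by apply/eqP; rewrite eq_le B_le0 B0.
  by rewrite expr0n !mulr0.
rewrite -lerBlDl -ler_pdivrMr ?exprn_gt0//; apply: lb_le_inf => // y /keyS.
by rewrite -lerBlDl -ler_pdivrMr ?exprn_gt0.
Qed.
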